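(* Given a positive index $I_{rel}\le c_n$, the following procedure builds the Dyck word of semilength $n$ whose relative index is $I_{rel}$, by constructing its Dyck path step by step. Any Dyck word starts with a left parenthesis, so the path starts with an up-step from $(0,0)$ to $(1,1)$, which lies on the outer (ascending) diagonal of the supporting triangle. Introduce a working variable equal to the required leap, $Jump=I_{rel}-1$ (if $I_{rel}=1$, the initial word of the range is specified and there are no jumps); the value of $Jump$ is to be decomposed into components, i.e. step-by-step movements over the $2n$-range. To decide where to move from $(1,1)$, up to $(2,2)$ or down to $(2,0)$, compare $Jump$ with the inverse dynamics $\breve d_{2,2}$ of the point $(2,2)$; the number of Dyck $2n$-paths that begin with two left parentheses is $\breve d_{2,2}=d_{2n-2,2}=c_n-c_{n-1}$. Three cases are possible. (1) $Jump<\breve d_{2,2}$: the leap skipping all words with two left parentheses at the beginning cannot be performed, so the path continues by an up-step from $(1,1)$ to $(2,2)$ without changing $Jump$ (perhaps the value of $Jump$ is then enough for the leap skipping the words that begin with three left parentheses, as $\breve d_{3,3}=d_{2n-3,3}=c_n-2c_{n-1}$). (2) $Jump>\breve d_{2,2}$: the leap is possible and must be made; make a down-step from $(1,1)$ to $(2,0)$, moving to the inner diagonal, and at the same time replace $Jump$ by $Jump-\breve d_{2,2}$. (3) $Jump=\breve d_{2,2}$: the leap is made (by the down-step), the resource $Jump$ is exhausted and all necessary jumps are performed; it remains to put the remaining up-steps and then the remaining down-steps of the Dyck path. The procedure is repeated in this way step by step while $Jump>0$.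
   Context: A Dyck word of semilength $n$ (Dyck $2n$-word) is a balanced string of $n$ left and $n$ right parentheses, in which no initial subword has more right than left parentheses. It corresponds to a Dyck $2n$-path from $(0,0)$ to $(2n,0)$, reading '(' as an up-step $(1,1)$ and ')' as a down-step $(1,-1)$; the path never goes below the $x$-axis. The Dyck series is the sequence of all nonempty Dyck words, ordered first by increasing length and, among words of equal length, lexicographically with '(' $<$ ')'. The $2n$-range is the block of Dyck words of length $2n$, and the relative index $I_{rel}$ of a Dyck $2n$-word is its ordinal number, starting from $1$, in this range. A leap (jump) is a movement along the $2n$-range that skips words with smaller indices. Here $c_n=\frac{(2n)!}{n!(n+1)!}$ is the $n$-th Catalan number; $d_{i,j}$ (the dynamics of the point $(i,j)$) is the number of lattice paths from $(0,0)$ to $(i,j)$ composed of up-steps and down-steps that never go below the $x$-axis; the inverse dynamics $\breve d_{i,j}=d_{2n-i,j}$ is the number of such paths leading from $(i,j)$ to the endpoint $(2n,0)$. The supporting triangle is the isosceles triangle with vertices $(0,0)$, $(n,n)$, $(2n,0)$; its outer ascending diagonal consists of the points $(i,i)$. *)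

(* Defs.v *)
From mathcomp Require Import all_boot all_order.

Set Implicit Arguments.
Unset Strict Implicit.
Unset Printing Implicit Defensive.

(* A word is a [seq bool], read simultaneously as a lattice path. The choice
   '(' = false, ')' = true makes the canonical order of [bool] the required
   '(' < ')', so that [seqlexi bool] carries the lexicographic order. *)
Definition lpar : bool := false.
Definition rpar : bool := true.

Definition ups (w : seq bool) : nat := count_mem lpar w.
Definition downs (w : seq bool) : nat := count_mem rpar w.

(* The path w started at height h never goes below the x-axis. *)
Definition nonneg_from (h : nat) (w : seq bool) : bool :=
  [forall k : 'I_(size w).+1, downs (take k w) <= h + ups (take k w)].

Definition is_dyck (n : nat) (w : seq bool) : bool :=
  [&& ups w == n, downs w == n & nonneg_from 0 w].

Definition catalan (n : nat) : nat := (2 * n)`! %/ (n`! * n.+1`!).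

(* Number of paths with l steps from height h to height h' that stay weakly
   above the x-axis. *)
Definition npaths (l h h' : nat) : nat :=
  #|[set s : l.-tuple bool | nonneg_from h s && (h + ups s == h' + downs s)]|.

(* Paths from (0,0) to (i,j). *)
Definition dynamics (i j : nat) : nat := npaths i 0 j.

(* Paths from (i,j) to (2n,0); meaningful for i <= 2n only. *)
Definition inv_dynamics (n i j : nat) : nat := npaths (2 * n - i) j 0.

Definition lexi_le (u v : seq bool) : bool :=
  ((u : seqlexi bool) <= (v : seqlexi bool))%O.

(* The 2n-range: all Dyck words of length 2n in lexicographic order. *)
Definition dyck_range (n : nat) : seq (seq bool) :=
  sort lexi_le [seq val t | t in [set t : (2 * n).-tuple bool | is_dyck n t]].

(* 1-based; only meaningful for words of the range. *)
Definition rel_index (n : nat) (w : seq bool) : nat :=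
  (index w (dyck_range n)).+1.

Definition num_prefixed (n : nat) (p : seq bool) : nat :=
  count (prefix p) (dyck_range n).

(* A state is the word written so far, which ends at the point
   (size w, ups w - downs w), together with the current value of Jump. *)
Definition state : Type := (seq bool * nat)%type.

Definition jump_step (n : nat) (st : state) : state :=
  let: (w, jump) := st in
  let b := inv_dynamics n (size w).+1 (ups w - downs w).+1 in
  if jump < b then (rcons w lpar, jump)
  else if b < jump then (rcons w rpar, jump - b)
  else (rcons w rpar, 0).

Definition state_after (n irel k : nat) : state :=
  iter k (jump_step n) ([:: lpar], irel - 1).

(* The remaining up-steps followed by the remaining down-steps. *)
Definition finish (n : nat) (w : seq bool) : seq bool :=
  w ++ nseq (n - ups w) lpar ++ nseq (n - downs w) rpar.

(* The loop "while Jump > 0" started on irel terminates, after exactly k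
   iterations, and the completed word is w. *)
Definition builds (n irel : nat) (w : seq bool) : Prop :=
  exists k : nat,
    [/\ forall m, m < k -> 0 < (state_after n irel m).2,
        (state_after n irel k).2 = 0
      & w = finish n (state_after n irel k).1].

(* Main.v *)
Require Import Defs.
From mathcomp Require Import all_boot all_order.
From mathcomp Require Import zify.

Set Implicit Arguments.
Unset Strict Implicit.
Unset Printing Implicit Defensive.

(** The Dyck words of length [2 * n] are the leaves of a binary tree
    whose nodes are the prefixes of Dyck words.  Reading the leaves from left to
    right, with the branch of '(' on the left, gives the lexicographic order,
    and the number of leaves below the prefix [w], which ends at the point
    [(i, j)], is the inverse dynamics of that point.  The procedure is
    therefore the descent in this tree towards the leaf number [irel - 1],
    counting from zero: [Jump] is the position of that leaf among the leaves
    below the current node, a down-step is made exactly when this position is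
    not covered by the left subtree, and the leaves of the left subtree are
    then subtracted from it.  When [Jump] is zero the leaf sought is the
    leftmost one, which is the remaining up-steps followed by the remaining
    down-steps.

    The list of leaves below a point at height [h] with [l] steps to go is
    [completions l h], defined by the branching recursion.  Lemmas
    [npaths_completions] and [dyck_rangeE] identify its length with the inverse
    dynamics and the whole list with the range, [jump_step_inv] is one step of
    the descent, and [completions_cons] computes the leftmost leaf.  The
    Catalan numbers come in through the ballot formula [ballot_completions],
    and the relations between dynamics and Catalan numbers are the branching
    recursion at the first few levels of the tree.  The two kinds of dynamics
    agree because a path read backwards is a path. *)

(** * Paths and their reversal *)

Lemma ups_cat u v : ups (u ++ v) = ups u + ups v.
Proof. exact: count_cat. Qed.

Lemma downs_cat u v : downs (u ++ v) = downs u + downs v.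
Proof. exact: count_cat. Qed.

Lemma ups_cons b w : ups (b :: w) = ~~ b + ups w.
Proof. by case: b. Qed.

Lemma downs_cons b w : downs (b :: w) = b + downs w.
Proof. by case: b. Qed.

Lemma ups_rcons w b : ups (rcons w b) = ups w + ~~ b.
Proof. by rewrite -cats1 ups_cat ups_cons addn0. Qed.

Lemma downs_rcons w b : downs (rcons w b) = downs w + b.
Proof. by rewrite -cats1 downs_cat downs_cons addn0. Qed.

Lemma ups_downs_size w : ups w + downs w = size w.
Proof. by elim: w => // b w; rewrite ups_cons downs_cons; case: b => /=; lia. Qed.

Lemma nonneg_fromP h w :
  reflect (forall k, k <= size w -> downs (take k w) <= h + ups (take k w))
          (nonneg_from h w).
Proof.
apply: (iffP forallP) => [nn k le_k | nn k]; last by apply: nn; rewrite -ltnS.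
by move: le_k; rewrite -ltnS => lt_k; apply: (nn (Ordinal lt_k)).
Qed.

Lemma nonneg_from_nil h : nonneg_from h [::].
Proof. by apply/nonneg_fromP => k _; case: k. Qed.

Lemma nonneg_from_cons h b w :
  nonneg_from h (b :: w) =
  if b then (0 < h) && nonneg_from h.-1 w else nonneg_from h.+1 w.
Proof.
apply/nonneg_fromP/idP => [nn | ].
  have nnw k : k <= size w ->
      b + downs (take k w) <= h + (~~ b + ups (take k w)).
    by move=> le_k; move: (nn k.+1 le_k); rewrite [take _ _]/= downs_cons ups_cons.
  case: b nn nnw => nn nnw; last first.
    by apply/nonneg_fromP => k /nnw /=; lia.
  have h_gt0 : 0 < h by have := nnw 0 isT; rewrite take0 /=; lia.
  by rewrite h_gt0; apply/nonneg_fromP => k /nnw /=; lia.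
case: b => [/andP[h_gt0 /nonneg_fromP nn] | /nonneg_fromP nn] [|k] le_k;
  rewrite ?take0 //;
  by rewrite [take _ _]/= downs_cons ups_cons; have := nn k le_k; lia.
Qed.

Definition reverse_path (w : seq bool) : seq bool := map negb (rev w).

Lemma reverse_pathK : involutive reverse_path.
Proof.
by move=> w; rewrite /reverse_path -map_rev revK mapK //; apply: negbK.
Qed.

Lemma ups_reverse w : ups (reverse_path w) = downs w.
Proof.
rewrite /ups /downs /reverse_path count_map count_rev.
by apply: eq_count => -[].
Qed.

Lemma downs_reverse w : downs (reverse_path w) = ups w.
Proof. by rewrite -[in RHS](reverse_pathK w) ups_reverse. Qed.

(** A prefix of the reversed path is the reversal of a suffix, and both endpoint
    conditions bound the height of the same point of the path. *)
Lemma nonneg_from_reverse h h' w :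
    h + ups w = h' + downs w -> nonneg_from h w ->
  nonneg_from h' (reverse_path w).
Proof.
move=> ends /nonneg_fromP nn; apply/nonneg_fromP => k.
rewrite size_map size_rev => le_k.
have -> : take k (reverse_path w) = reverse_path (drop (size w - k) w).
  by rewrite /reverse_path -map_take take_rev.
rewrite downs_reverse ups_reverse.
have := nn (size w - k) (leq_subr _ _).
move: ends; rewrite -{1 2}(cat_take_drop (size w - k) w) ups_cat downs_cat.
lia.
Qed.

(** Reversal injects the paths from [h] to [h'] into those from [h'] to [h]; an
    inequality suffices, since it can be used in both directions. *)
Lemma npaths_reverse_le l h h' : npaths l h h' <= npaths l h' h.
Proof.
pose r (t : l.-tuple bool) : l.-tuple bool := [tuple of map negb (rev t)].
have r_inj : injective r.
  move=> s t /(congr1 val) /= eq_st; apply: val_inj.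
  by apply: (can_inj reverse_pathK).
rewrite /npaths -(card_imset _ r_inj); apply: subset_leq_card.
apply/subsetP => _ /imsetP[s + ->]; rewrite !inE => /andP[nn /eqP ends].
rewrite -[tval (r s)]/(reverse_path s) ups_reverse downs_reverse.
by rewrite (nonneg_from_reverse ends nn) ends /=.
Qed.

Lemma npathsC l h h' : npaths l h h' = npaths l h' h.
Proof. by apply/eqP; rewrite eqn_leq !npaths_reverse_le. Qed.

(** * Completions of a prefix in lexicographic order *)

(** The left-to-right list of leaves below a point at height [h] with [l]
    letters to go; '(' comes first in the recursion so that the list comes out
    in lexicographic order. *)
Fixpoint completions (l h : nat) : seq (seq bool) :=
  if l is l'.+1 then
    map (cons lpar) (completions l' h.+1)
    ++ (if h is h'.+1 then map (cons rpar) (completions l' h') else [::])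
  else if h is 0 then [:: [::]] else [::].

Lemma mem_map_cons (b c : bool) w s :
  (b :: w \in map (cons c) s) = (b == c) && (w \in s).
Proof.
have [<- | neq_bc] /= := eqVneq b c; first by rewrite mem_map // => u v [].
by apply/mapP => -[u _ [eq_bc _]]; rewrite eq_bc eqxx in neq_bc.
Qed.

Lemma mem_completions l h w :
  (w \in completions l h) =
  [&& size w == l, nonneg_from h w & h + ups w == downs w].
Proof.
elim: l h w => [|l IHl] h [|b w].
- by case: h => [|h] //; rewrite nonneg_from_nil.
- by case: h.
- rewrite /= mem_cat; apply/norP; split; first by apply/mapP => -[].
  by case: h => [|h] //; apply/mapP => -[].
rewrite [completions _ _]/= [size _]/= mem_cat nonneg_from_cons.
rewrite ups_cons downs_cons eqSS.
case: h => [|h]; case: b; rewrite ?in_nil ?mem_map_cons ?IHl //= ?andbF //;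
  by rewrite orbF; congr [&& _, _ & _]; lia.
Qed.

Lemma completions_uniq l h : uniq (completions l h).
Proof.
have cons_uniq (b : bool) s : uniq (map (cons b) s) = uniq s.
  by apply: map_inj_uniq => u v [].
elim: l h => [|l IHl] [|h] //=; first by rewrite cats0 cons_uniq.
rewrite cat_uniq !cons_uniq !IHl andbT /=.
by apply/hasPn => _ /mapP[u _ ->]; rewrite mem_map_cons.
Qed.

Lemma lexi_le_cons b u c v :
  lexi_le (b :: u) (c :: v) = (b <= c) && ((b == c) ==> lexi_le u v).
Proof.
by rewrite /lexi_le Order.SeqLexiOrder.Exports.lexi_cons; case: b; case: c.
Qed.

Lemma completions_sorted l h : sorted lexi_le (completions l h).
Proof.
have cons_pairwise b s : pairwise lexi_le (map (cons b) s) = pairwise lexi_le s.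
  rewrite pairwise_map; apply: eq_pairwise => u v.
  by rewrite /= lexi_le_cons leqnn eqxx.
apply: pairwise_sorted.
elim: l h => [|l IHl] [|h] //=; first by rewrite cats0 cons_pairwise.
rewrite pairwise_cat !cons_pairwise !IHl !andbT.
by apply/allrelP => _ _ /mapP[u _ ->] /mapP[v _ ->]; rewrite lexi_le_cons.
Qed.

Lemma perm_tuples l (P : pred (seq bool)) (s : seq (seq bool)) :
    uniq s -> (forall w, (w \in s) = (size w == l) && P w) ->
  perm_eq [seq val t | t in [set t : l.-tuple bool | P t]] s.
Proof.
move=> s_uniq mem_s; apply: uniq_perm => // [|w].
  by rewrite map_inj_uniq ?enum_uniq //; apply: val_inj.
rewrite mem_s; apply/mapP/andP => [[t] | [size_w Pw]].
  by rewrite mem_enum inE => Pt ->; rewrite size_tuple.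
by exists (Tuple size_w); rewrite ?mem_enum ?inE.
Qed.

Lemma npaths_completions l h : npaths l h 0 = size (completions l h).
Proof.
pose P w := nonneg_from h w && (h + ups w == downs w).
have <- := perm_size (@perm_tuples l P _ (completions_uniq l h)
                                      (mem_completions l h)).
by rewrite size_map -cardE.
Qed.

Lemma mem_completions_dyck n w : (w \in completions (2 * n) 0) = is_dyck n w.
Proof.
rewrite mem_completions /is_dyck add0n -ups_downs_size.
by case: (nonneg_from 0 w); rewrite ?andbF //=; lia.
Qed.

(** Both lists are sorted for the same total order, and they have the same
    elements without repetition. *)
Lemma dyck_rangeE n : dyck_range n = completions (2 * n) 0.
Proof.
have lexi_total : total lexi_le by move=> u v; apply: Order.TotalTheory.le_total.
have lexi_trans : transitive lexi_le.
  by move=> v u w; apply: Order.POrderTheory.le_trans.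
have lexi_anti : antisymmetric lexi_le.
  by move=> u v; apply: Order.POrderTheory.le_anti.
apply: (sorted_eq lexi_trans lexi_anti).
- exact: sort_sorted.
- exact: completions_sorted.
rewrite /dyck_range perm_sort.
apply: perm_tuples (completions_uniq _ _) _ => w.
rewrite mem_completions_dyck /is_dyck -ups_downs_size.
by case: (nonneg_from 0 w); rewrite ?andbF //=; lia.
Qed.

(** Following the left branch [k] times leads to the point [k] steps further and
    [k] units higher, below which lie the words that start with [k] up-steps. *)
Lemma count_prefix_ups k l h :
  count (prefix (nseq k lpar)) (completions (k + l) h)
  = size (completions l (h + k)).
Proof.
elim: k h => [|k IHk] h.
  rewrite addn0; apply/eqP; rewrite -all_count; apply/allP => w _.
  exact: prefix0s.
rewrite addSn /= count_cat count_map.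
have -> : count (preim (cons lpar) (prefix (lpar :: nseq k lpar)))
                (completions (k + l) h.+1)
        = count (prefix (nseq k lpar)) (completions (k + l) h.+1).
  by apply: eq_count.
rewrite IHk addSnnS; case: h => [|h]; first by rewrite addn0.
by rewrite count_map (eq_count (a2 := pred0)) ?count_pred0 ?addn0.
Qed.

(** * Counting completions *)

Lemma size_completionsS l h :
  size (completions l.+1 h)
  = size (completions l h.+1) + (0 < h) * size (completions l h.-1).
Proof.
by rewrite /= size_cat size_map; case: h => [|h]; rewrite ?size_map ?mul1n.
Qed.

Lemma completions_short l h : l < h -> completions l h = [::].
Proof.
elim: l h => [|l IHl] [|h] //= lt_lh.
by rewrite !IHl //; lia.
Qed.

Lemma completions_diag h : completions h h = [:: nseq h rpar].
Proof. by elim: h => //= h ->; rewrite completions_short. Qed.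

(** The ballot formula in a division-free form: a path descending from height
    [h] to the axis has [u] up-steps and [u + h] down-steps for some [u].  The
    first step leads to one of the two neighbouring cases, hence the double
    induction. *)
Lemma ballot_completions u h :
  size (completions (2 * u + h) h) * (u`! * (u + h).+1`!)
  = h.+1 * (2 * u + h)`!.
Proof.
elim: u h => [|u IHu] h; first by rewrite completions_diag factS !mul1n.
elim: h => [|h IHh].
  have := IHu 1; rewrite !addn1 => IH.
  have -> : 2 * u.+1 + 0 = (2 * u).+2 by lia.
  rewrite size_completionsS mul0n !addn0 (factS u) (factS (2 * u).+1).
  transitivity (u.+1 * (size (completions (2 * u).+1 1) * (u`! * u.+2`!))).
    by rewrite -!mulnA; nia.
  by rewrite IH; nia.
have := IHu h.+2.
have -> : 2 * u.+1 + h.+1 = (2 * u + h.+2).+1 by lia.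
have E : 2 * u.+1 + h = 2 * u + h.+2 by lia.
rewrite E in IHh.
rewrite size_completionsS mul1n /= (factS (2 * u + h.+2)).
move: IHh.
have -> : u.+1 + h.+1 = (u + h.+2) by lia.
have -> : (u.+1 + h).+1 = u + h.+2 by lia.
rewrite (factS (u + h.+2)) (factS u).
move: (size _) (size _) (_`!) (_`!) (_`!) => x y f g k.
nia.
Qed.

Lemma catalanE n : catalan n = size (completions (2 * n) 0).
Proof.
have := ballot_completions n 0; rewrite !addn0 mul1n => ballot.
by rewrite /catalan -ballot mulnK // muln_gt0 !fact_gt0.
Qed.

Lemma irel_lt_size n irel :
  0 < irel <= catalan n -> irel - 1 < size (dyck_range n).
Proof.
by rewrite dyck_rangeE catalanE subn1 => /andP[irel_gt0]; rewrite prednK.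
Qed.

(** * The descent *)

(** The leftmost completion is the one that climbs first. *)
Lemma completions_cons u h :
  exists s, completions (u + (u + h)) h
            = (nseq u lpar ++ nseq (u + h) rpar) :: s.
Proof.
elim: u h => [|u IHu] h; first by exists [::]; rewrite completions_diag.
have [s def_s] := IHu h.+1.
rewrite [u.+1 + _]addSn [completions _ _]/= !addSnnS def_s; eexists; reflexivity.
Qed.

Definition height (w : seq bool) : nat := ups w - downs w.

(** The invariant of the descent: the leaf [t] lies below the node [w], with
    exactly [jump] leaves of that subtree to its left. *)
Definition located (n : nat) (t : seq bool) (st : state) : Prop :=
  let: (w, jump) := st in
  let c := completions (2 * n - size w) (height w) in
  [/\ downs w <= ups w, jump < size c & t = w ++ nth [::] c jump].

(** The bound compared with [jump] is the number of leaves of the left subtree.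
    If [jump] reaches it, the position in the right subtree is [jump] minus that
    number, so that the case of equality is the general case with result zero.
    A leaf to the right of the left subtree exists only if the height is
    positive, which is why the down-step never leaves the upper half-plane. *)
Lemma jump_step_inv n t st :
  size st.1 < 2 * n -> located n t st -> located n t (jump_step n st).
Proof.
case: st => w jump /= lt_w [le_du lt_jump ->].
have [l def_l] : exists l, 2 * n - size w = l.+1.
  by exists (2 * n - size w).-1; lia.
have def_l' : 2 * n - (size w).+1 = l by lia.
rewrite /inv_dynamics npaths_completions -/(height w) def_l'.
move: lt_jump; rewrite def_l size_completionsS => lt_jump.
set b := size (completions l (height w).+1) in lt_jump *.
have step_down : b <= jump -> located n
    (w ++ nth [::] (completions l.+1 (height w)) jump)
    (rcons w rpar, jump - b).
  move=> le_b; rewrite /located size_rcons def_l' ups_rcons downs_rcons.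
  have h_gt0 : 0 < height w by case: (height w) lt_jump => [|h]; lia.
  have -> : height (rcons w rpar) = (height w).-1.
    by rewrite /height ups_rcons downs_rcons /=; lia.
  split; first by move: h_gt0; rewrite /height /=; lia.
    by move: lt_jump; rewrite h_gt0 mul1n; lia.
  move: lt_jump; rewrite /= nth_cat size_map -/b (ltnNge jump b) le_b /= cat_rcons.
  case: (height w) h_gt0 => // h _; rewrite mul1n /= => lt_jump.
  by rewrite (nth_map [::]) //=; lia.
have [lt_b | le_b] := ltnP jump b; last first.
  by move: (step_down le_b); case: ltngtP le_b => // <-; rewrite subnn.
rewrite /located size_rcons def_l' ups_rcons downs_rcons.
have -> : height (rcons w lpar) = (height w).+1.
  by rewrite /height ups_rcons downs_rcons /=; lia.
split=> //; first by rewrite addn0 ltnW // addn1.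
by rewrite /= nth_cat size_map lt_b (nth_map [::]) // cat_rcons.
Qed.

Lemma size_state_after n irel k : size (state_after n irel k).1 = k.+1.
Proof.
elim: k => //= k; rewrite /state_after; case: (iter _ _ _) => w jump /= <-.
by rewrite -(size_rcons w lpar); do 2?case: ifP => _; rewrite /= !size_rcons.
Qed.

Lemma located_start n irel :
    0 < n -> 0 < irel <= catalan n ->
  located n (nth [::] (dyck_range n) (irel - 1)) (state_after n irel 0).
Proof.
rewrite catalanE dyck_rangeE; case: n => // n _ /andP[irel_gt0 le_irel].
have def_l : 2 * n.+1 = (2 * n).+2 by lia.
have lt_irel : irel - 1 < size (completions (2 * n).+1 1).
  by move: le_irel; rewrite def_l size_completionsS mul0n; lia.
rewrite -[state_after _ _ _]/([:: lpar], irel - 1) /located def_l.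
rewrite -[height _]/1 (subn1 (2 * n).+2) [_.-1]/=; split=> //.
by rewrite [completions _.+2 0]/= cats0 (nth_map [::]).
Qed.

Lemma located_state_after n irel k :
    0 < n -> 0 < irel <= catalan n -> k < 2 * n ->
  located n (nth [::] (dyck_range n) (irel - 1)) (state_after n irel k).
Proof.
move=> n_gt0 irel_ok; elim: k => [|k IHk] lt_k; first exact: located_start.
apply: jump_step_inv; last by apply: IHk; apply: ltnW.
by rewrite -/(state_after n irel k) size_state_after.
Qed.

Lemma located_leftmost n t w :
  is_dyck n t -> located n t (w, 0) -> t = finish n w.
Proof.
move=> /and3P[/eqP ups_t /eqP downs_t _] [le_du _ def_t].
have le_u : ups w <= n by rewrite -ups_t def_t ups_cat leq_addr.
have le_d : downs w <= n by lia.
rewrite def_t /finish; congr (_ ++ _).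
have [s] := completions_cons (n - ups w) (height w).
have -> : n - ups w + height w = n - downs w by rewrite /height; lia.
have -> : n - ups w + (n - downs w) = 2 * n - size w.
  by rewrite -ups_downs_size; lia.
by move=> ->.
Qed.

(** When all [2 * n] letters have been written there is only one leaf below the
    node, so [Jump] has reached zero. *)
Lemma builds_nth n irel :
    0 < n -> 0 < irel <= catalan n ->
  builds n irel (nth [::] (dyck_range n) (irel - 1)).
Proof.
move=> n_gt0 irel_ok; set t := nth _ _ _.
have t_dyck : is_dyck n t.
  by rewrite -mem_completions_dyck -dyck_rangeE mem_nth // irel_lt_size.
have loc k := @located_state_after n irel k n_gt0 irel_ok.
have last_k : (2 * n).-1 < 2 * n by lia.
have stop : (state_after n irel (2 * n).-1).2 == 0.
  move: (loc _ last_k) (size_state_after n irel (2 * n).-1).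
  case: (state_after _ _ _) => w jump /= [_ + _] size_w.
  rewrite size_w prednK ?muln_gt0 // subnn.
  by case: (height w) => [|h]; case: jump.
have ex_stop : exists k, (state_after n irel k).2 == 0 by exists (2 * n).-1.
case: (ex_minnP ex_stop) => k /eqP stop_k min_k.
exists k; split=> // [m lt_mk|].
  by rewrite lt0n; apply: contraL lt_mk => /min_k; rewrite -leqNgt.
apply: (located_leftmost t_dyck).
by rewrite -stop_k -surjective_pairing; apply: loc; have := min_k _ stop; lia.
Qed.

Theorem mainTheorem6 (n irel : nat) (hn : 0 < n)
    (hirel : 0 < irel <= catalan n) :
  [/\ forall i j : nat, i <= 2 * n ->
        inv_dynamics n i j = dynamics (2 * n - i) j,
      [/\ num_prefixed n [:: lpar; lpar] = inv_dynamics n 2 2,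
          inv_dynamics n 2 2 = dynamics (2 * n - 2) 2
        & dynamics (2 * n - 2) 2 + catalan (n - 1) = catalan n],
      1 < n ->
        [/\ num_prefixed n [:: lpar; lpar; lpar] = inv_dynamics n 3 3,
            inv_dynamics n 3 3 = dynamics (2 * n - 3) 3
          & dynamics (2 * n - 3) 3 + 2 * catalan (n - 1) = catalan n]
    & exists w : seq bool,
        [/\ builds n irel w, is_dyck n w, rel_index n w = irel
          & forall v : seq bool,
              is_dyck n v -> rel_index n v = irel -> v = w]].
Proof.
have inv_dyn i j : inv_dynamics n i j = dynamics (2 * n - i) j by apply: npathsC.
have dynE l h : dynamics l h = size (completions l h).
  by rewrite /dynamics npathsC npaths_completions.
have num_ups k : k <= 2 * n ->
    num_prefixed n (nseq k lpar) = inv_dynamics n k k.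
  move=> le_k; rewrite inv_dyn dynE /num_prefixed dyck_rangeE.
  by rewrite -{1}(subnKC le_k) count_prefix_ups.
(* The first step is forced; the second leads either to height 2 or back to
   the axis, where a Dyck path of semilength n - 1 remains. *)
have dyn2 : dynamics (2 * n - 2) 2 + catalan (n - 1) = catalan n.
  rewrite dynE !catalanE.
  have -> : 2 * n = (2 * (n - 1)).+2 by lia.
  by rewrite !size_completionsS !subSS subn0 mul0n mul1n addn0.
split=> // [|n_gt1|].
- by split=> //; apply: (num_ups 2); lia.
- split=> //; first by apply: (num_ups 3); lia.
  (* From the axis the next step is forced up to height 1. *)
  have size1 : catalan (n - 1) = size (completions (2 * n - 3) 1).
    rewrite catalanE.
    have -> : 2 * (n - 1) = (2 * n - 3).+1 by lia.
    by rewrite size_completionsS mul0n addn0.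
  rewrite -dyn2 (mul2n (catalan _)) -addnn addnA; congr (_ + _).
  have -> : 2 * n - 2 = (2 * n - 3).+1 by lia.
  by rewrite !dynE size_completionsS mul1n size1.
have lt_irel := irel_lt_size hirel.
exists (nth [::] (dyck_range n) (irel - 1)); split.
- exact: builds_nth.
- by rewrite -mem_completions_dyck -dyck_rangeE mem_nth.
- rewrite /rel_index index_uniq //; first by lia.
  by rewrite dyck_rangeE completions_uniq.
move=> v v_dyck <-; rewrite /rel_index subn1 nth_index //.
by rewrite dyck_rangeE mem_completions_dyck.
Qed.
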